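(* Let $k$ be a field, let $M\neq0$ be a finitely generated graded module over the standard graded polynomial ring $k[x_0,\dots,x_{n-1}]$, and let $D:=\operatorname{reg}(M)-\operatorname{r}(M)$ be the difference between the Castelnuovo-Mumford regularity and the regularity of the Hilbert function of $M$. Then $D+1$ is the least non-negative integer $\lambda\ge0$ such that $$\sum_i(-1)^i\beta_{i,\operatorname{reg}(M)+n-\lambda}\neq0,$$ where the $\beta_{i,j}$ are the graded Betti numbers of $M$.
   Context: $\beta_{i,j}$ is the number of generators of degree $j$ of the $i$-th free module in a minimal graded free resolution of $M$ over $k[x_0,\dots,x_{n-1}]$ ($\deg x_i=1$), and $\operatorname{reg}(M)=\max\{j-i:\beta_{i,j}\neq0\}$. The regularity of the Hilbert function $\operatorname{r}(M)$ is the least integer $r$ such that the Hilbert function $s\mapsto\dim_k M_s$ ($s\in\mathbb{Z}$) and the Hilbert polynomial of $M$ agree at every integer $s\ge r$. *)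

(* Defs.v *)
From mathcomp Require Import all_boot all_order all_algebra.
From mathcomp Require Import boolp classical_sets fsbigop.
From mathcomp Require Import mpoly.

Set Implicit Arguments.
Unset Strict Implicit.
Unset Printing Implicit Defensive.

Import Order.TTheory GRing.Theory Num.Theory.
Local Open Scope classical_set_scope.
Local Open Scope ring_scope.

Definition least (A : set int) : set int := A `&` lbound A.
Definition greatest (A : set int) : set int := A `&` ubound A.

(* [p] is homogeneous of degree [d] for an integer [d]; the zero polynomial is
   homogeneous of every degree, and is the only one in negative degrees. *)
Definition zhomog (k : fieldType) (n : nat) (d : int) (p : {mpoly k[n]}) : Prop :=
  match d with
  | Posz e => p \is e.-homog
  | Negz _ => p = 0
  end.

(* A Z-grading M = (+)_s M_s of a module over the standard graded polynomial
   ring; the last two fields say that M is the internal direct sum of the M_s. *)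
Record grading (k : fieldType) (n : nat) (M : lmodType {mpoly k[n]}) := Grading {
  comp :> int -> set M;
  comp0 : forall s, comp s 0;
  compD : forall s u v, comp s u -> comp s v -> comp s (u + v);
  compZ : forall (d : nat) s (p : {mpoly k[n]}) v,
    p \is d.-homog -> comp s v -> comp (s + d%:Z) (p *: v);
  comp_span : forall v, exists (r : seq int) (f : int -> M),
    (forall s, comp s (f s)) /\ v = \sum_(s <- r) f s;
  comp_indep : forall (r : seq int) (f : int -> M),
    uniq r -> (forall s, comp s (f s)) -> \sum_(s <- r) f s = 0 ->
    forall s, s \in r -> f s = 0
}.

Definition finitely_generated (k : fieldType) (n : nat)
    (M : lmodType {mpoly k[n]}) : Prop :=
  exists (m : nat) (g : 'I_m -> M), forall v,
    exists c : 'rV[{mpoly k[n]}]_m, v = \sum_(l < m) c 0 l *: g l.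

Section HilbertFunction.

Variables (k : fieldType) (n : nat) (M : lmodType {mpoly k[n]}).

(* [b] is a basis over [k] of the k-subspace [V] of [M]; the field acts through
   the constant polynomials. *)
Definition kbasis (V : set M) (d : nat) (b : 'I_d -> M) : Prop :=
  (forall l, V (b l)) /\
  (forall v, V v -> exists! c : 'rV[k]_d, v = \sum_(l < d) (c 0 l)%:MP *: b l).

(* The default value 0 is only used for infinite-dimensional [V]. *)
Definition kdim (V : set M) : nat :=
  xget 0%N [set d : nat | exists b : 'I_d -> M, kbasis V b].

Variable G : grading M.

Definition hilbert_function (s : int) : nat := kdim (G s).

Definition hilbert_polynomial : {poly rat} :=
  xget 0 [set p : {poly rat} | exists s0 : int, forall s : int, s0 <= s ->
    (hilbert_function s)%:R = p.[s%:~R]].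

Definition hilbert_regularity : int :=
  xget 0 (least [set r : int | forall s : int, r <= s ->
    (hilbert_function s)%:R = hilbert_polynomial.[s%:~R]]).

End HilbertFunction.

(* A minimal graded free resolution ... -> F_1 -> F_0 -> M -> 0.
   F_i = (+)_l S(- fdeg i l) has a homogeneous basis e_l of degree [fdeg i l],
   its elements are the row vectors of coordinates, and F_(i+1) -> F_i is right
   multiplication by [dif i].  Minimality says im(F_(i+1)) is contained in
   (x_0, ..., x_(n-1)) F_i.  No bound on the length is imposed. *)
Record min_free_resolution (k : fieldType) (n : nat) (M : lmodType {mpoly k[n]})
    (G : grading M) := MinFreeResolution {
  rk : nat -> nat;
  fdeg : forall i, 'I_(rk i) -> int;
  aug : 'I_(rk 0) -> M;
  dif : forall i, 'M[{mpoly k[n]}]_(rk i.+1, rk i);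
  aug_homog : forall l, G (fdeg l) (aug l);
  dif_homog : forall i l m, zhomog (fdeg l - fdeg m) (dif i l m);
  dif_minimal : forall i l m, (dif i l m)@_0%MM = 0;
  aug_surj : forall v : M, exists u : 'rV[{mpoly k[n]}]_(rk 0),
    v = \sum_l u 0 l *: aug l;
  aug_exact : forall u : 'rV[{mpoly k[n]}]_(rk 0),
    \sum_l u 0 l *: aug l = 0 <-> exists w, u = w *m dif 0;
  dif_exact : forall i (u : 'rV[{mpoly k[n]}]_(rk i.+1)),
    u *m dif i = 0 <-> exists w, u = w *m dif i.+1
}.

Section Betti.

Variables (k : fieldType) (n : nat) (M : lmodType {mpoly k[n]}).
Variables (G : grading M) (F : min_free_resolution G).

Definition betti (i : nat) (j : int) : nat :=
  #|[pred l : 'I_(rk F i) | fdeg l == j]|.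

Definition regularity : int :=
  xget 0 (greatest [set m : int | exists i j, betti i j <> 0%N /\ m = j - i%:Z]).

(* sum_i (-1)^i beta_(i,j), a sum with finite support over all i : nat *)
Definition alt_betti (j : int) : int :=
  \sum_(i \in [set: nat]) (-1) ^+ i * (betti i j)%:Z.

End Betti.

(* Main.v *)
Require Import Defs.
From mathcomp Require Import all_boot all_order all_algebra.
From mathcomp Require Import boolp classical_sets fsbigop.
From mathcomp Require Import mpoly.
From mathcomp Require Import zify.

(** Write [chi j] for the alternating sum of the Betti numbers in degree [j]
    and [S] for the polynomial ring in [n] variables.

    In each degree [s] the resolution is an exact sequence of
    finite-dimensional spaces, so the Hilbert function of [M] at [s] is the sum
    over [j] of [chi j * dim S_(s - j)] (hilbert_function_alt_betti).  The
    function [d |-> dim S_d] agrees with a polynomial for all [d > - n]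
    (monomials_polyE), and differs from it at [d = - n]
    (monomials_poly_opp).  Let [J] be the last degree with [chi J <> 0].
    Replacing every [dim S_(s - j)] by the polynomial value gives the Hilbert
    polynomial of [M], and the error is zero for [s > J - n], while at
    [s = J - n] only the term of [J] contributes, with a nonzero error.  Hence
    [r(M) = J - n + 1] (hilbert_regularityE), that is
    [D + 1 = reg(M) + n - J], and the degrees [reg(M) + n - lam] with
    [0 <= lam < D + 1] are exactly those beyond [J] that are at most
    [reg(M) + n].

    What remains is that [reg(M)] is a maximum and that [D + 1 >= 0], i.e.
    [J <= reg(M) + n].  Both follow from the syzygy theorem for the given
    resolution: its modules vanish beyond position [n] (resolution_length).
    Instead of comparing with the Koszul complex, one adds the variables to the
    base ideal one at a time.  If the resolution modulo the first [t] variables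
    is exact from position [t + 1] on, then it stays exact one position later
    modulo one more variable, because the variables form a regular sequence
    (exact_mod_vars).  Modulo all variables the differentials of a minimal
    resolution are zero, so exactness there means that the modules are zero. *)

Set Implicit Arguments.
Unset Strict Implicit.
Unset Printing Implicit Defensive.

Import Order.TTheory GRing.Theory Num.Theory.

Local Open Scope classical_set_scope.
Local Open Scope ring_scope.

(** * Dimensions of k-subspaces *)

Section KSubspaces.

Variables (k : fieldType) (n : nat).
Implicit Types M N : lmodType {mpoly k[n]}.

Definition kcomb M d (b : 'I_d -> M) (c : 'rV[k]_d) : M :=
  \sum_(l < d) (c 0 l)%:MP *: b l.

Definition ksubspace M (V : set M) : Prop :=
  [/\ V 0, forall u v, V u -> V v -> V (u + v)
    & forall (a : k) v, V v -> V (a%:MP *: v)].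

Definition klinear M N (f : M -> N) : Prop :=
  (forall u v, f (u + v) = f u + f v) /\
  (forall (a : k) v, f (a%:MP *: v) = a%:MP *: f v).

Definition hasdim M (V : set M) (d : nat) : Prop :=
  exists b : 'I_d -> M, kbasis V b.

Section Combinations.

Variables (M : lmodType {mpoly k[n]}) (d : nat) (b : 'I_d -> M).

Lemma kcombD c c' : kcomb b (c + c') = kcomb b c + kcomb b c'.
Proof.
rewrite /kcomb -big_split /=; apply: eq_bigr => l _.
by rewrite mxE mpolyCD scalerDl.
Qed.

Lemma kcombZ (a : k) c : kcomb b (a *: c) = a%:MP *: kcomb b c.
Proof.
rewrite /kcomb scaler_sumr; apply: eq_bigr => l _.
by rewrite mxE mpolyCM scalerA.
Qed.

Lemma kcomb0 : kcomb b 0 = 0.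
Proof. by rewrite /kcomb big1 // => l _; rewrite mxE mpolyC0 scale0r. Qed.

Lemma kcombN c : kcomb b (- c) = - kcomb b c.
Proof. by rewrite -[- c]scaleN1r kcombZ mpolyCN scaleN1r. Qed.

Lemma kcomb_sum I (r : seq I) (P : pred I) (F : I -> 'rV[k]_d) :
  kcomb b (\sum_(i <- r | P i) F i) = \sum_(i <- r | P i) kcomb b (F i).
Proof. exact: (big_morph (kcomb b) kcombD kcomb0). Qed.

Lemma kcomb_delta l : kcomb b (delta_mx 0 l) = b l.
Proof.
rewrite /kcomb (bigD1 l) //= mxE !eqxx scale1r big1 ?addr0 // => i il.
by rewrite mxE eqxx (negbTE il) mpolyC0 scale0r.
Qed.

Lemma kcomb_mulmx e (A : 'M[k]_(e, d)) c :
  kcomb b (c *m A) = kcomb (fun i => kcomb b (row i A)) c.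
Proof.
rewrite mulmx_sum_row kcomb_sum; apply: eq_bigr => i _.
by rewrite kcombZ.
Qed.

Lemma ksubspace_kcomb (V : set M) c :
  ksubspace V -> (forall l, V (b l)) -> V (kcomb b c).
Proof.
by case=> V0 VD VZ Vb; apply: big_ind => // l _; apply: VZ.
Qed.

Lemma klinear0 N (f : M -> N) : klinear f -> f 0 = 0.
Proof. by case=> _ fZ; rewrite -(scale0r (0 : M)) -mpolyC0 fZ mpolyC0 scale0r. Qed.

Lemma klinear_kcomb N (f : M -> N) c :
  klinear f -> f (kcomb b c) = kcomb (f \o b) c.
Proof.
move=> fL; have [fD fZ] := fL.
rewrite /kcomb (big_morph f fD (klinear0 fL)).
by apply: eq_bigr => l _; rewrite fZ.
Qed.

Lemma kbasisP (V : set M) : ksubspace V ->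
  kbasis V b <-> [/\ forall l, V (b l),
    forall v, V v -> exists c, v = kcomb b c
    & forall c, kcomb b c = 0 -> c = 0].
Proof.
case=> V0 VD VZ; split=> [[Vb Vgen]|[Vb Vgen Vfree]]; split=> //.
- by move=> v /Vgen[c [-> _]]; exists c.
- move=> c c0; have [c' [_ c'u]] := Vgen 0 V0.
  by rewrite -(c'u c) ?(c'u 0) // -/(kcomb b _) ?kcomb0 ?c0.
- move=> v /Vgen[c ->]; exists c; split=> // c' cc'.
  apply/esym/eqP; rewrite -subr_eq0; apply/eqP/Vfree.
  by rewrite kcombD kcombN -[kcomb b c']cc' subrr.
Qed.

End Combinations.

(** The two matrices of coordinates multiply to the identity. *)
Lemma hasdim_leq M (V : set M) d e : ksubspace V ->
  hasdim V d -> hasdim V e -> (d <= e)%N.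
Proof.
move=> VS [b /(kbasisP b VS)[Vb bgen bfree]] [b' /(kbasisP b' VS)[Vb' bgen' _]].
have /choice[A Ab] l : exists c, b l = kcomb b' c by exact: bgen'.
have /choice[A' Ab'] l : exists c, b' l = kcomb b c by exact: bgen.
pose B := \matrix_l A l; pose B' := \matrix_l A' l.
apply: (@mulmx1_min k _ _ B B'); apply/row_matrixP => i.
apply/eqP; rewrite -subr_eq0; apply/eqP/bfree.
rewrite kcombD kcombN row1 kcomb_delta row_mul rowK kcomb_mulmx.
rewrite [X in X - _](_ : _ = kcomb b' (A i)) ?Ab ?subrr //.
by apply: eq_bigr => l _; rewrite rowK -Ab'.
Qed.

Lemma kdimE M (V : set M) d : ksubspace V -> hasdim V d -> kdim V = d.
Proof.
move=> VS Vd; apply: xget_unique => // e Ve.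
by apply/eqP; rewrite eqn_leq !(hasdim_leq VS).
Qed.

Lemma hasdim0 M (V : set M) v : hasdim V 0 -> V v -> v = 0.
Proof. by case=> b [_ bgen] /bgen[c [-> _]]; rewrite big_ord0. Qed.

(** A basis is recognised by a dual family of functionals that separates the
    points of the subspace; this computes dimensions from explicit monomials
    without solving for coordinates. *)
Lemma hasdim_dual M (V : set M) (T : finType) (b : T -> M) (phi : T -> M -> k) :
    ksubspace V -> (forall t, V (b t)) ->
    (forall t u v, phi t (u + v) = phi t u + phi t v) ->
    (forall t a v, phi t (a%:MP *: v) = a * phi t v) ->
    (forall t t', phi t (b t') = (t == t')%:R) ->
    (forall v, V v -> (forall t, phi t v = 0) -> v = 0) ->
  hasdim V #|T|.
Proof.
move=> VS Vb phiD phiZ phib sepV; have [V0 VD VZ] := VS.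
pose b' (i : 'I_#|T|) := b (enum_val i).
have phi0 t : phi t 0 = 0.
  by rewrite -(scale0r (0 : M)) -mpolyC0 phiZ mul0r.
have phi_comb c i : phi (enum_val i) (kcomb b' c) = c 0 i.
  rewrite (big_morph _ (phiD _) (phi0 _)) (bigD1 i) //= phiZ phib eqxx mulr1.
  rewrite big1 ?addr0 // => j ji; rewrite phiZ phib.
  by rewrite (inj_eq enum_val_inj) eq_sym (negbTE ji) mulr0.
exists b'; apply/kbasisP => //; split=> [l|v Vv|c c0]; first exact: Vb.
- exists (\row_i phi (enum_val i) v); apply/eqP; rewrite -subr_eq0; apply/eqP.
  apply: sepV => [|t].
    apply: VD => //; rewrite -kcombN; apply: ksubspace_kcomb => // l.
    exact: Vb.
  by rewrite -(enum_rankK t) -kcombN phiD phi_comb !mxE subrr.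
- by apply/rowP => i; rewrite -phi_comb c0 phi0 mxE.
Qed.

(** A matrix of maximal rank with rows in the subspace spans it, since a vector
    outside its row space could be added to increase the rank. *)
Lemma subspace_rowspace d (P : 'rV[k]_d -> Prop) :
    P 0 -> (forall u v, P u -> P v -> P (u + v)) ->
    (forall a v, P v -> P (a *: v)) ->
  exists A : 'M[k]_d, forall v, P v <-> (v <= A)%MS.
Proof.
move=> P0 PD PZ.
pose inP (A : 'M[k]_d) := forall v, (v <= A)%MS -> P v.
pose Q r := `[< exists A, inP A /\ \rank A = r >].
have exQ : exists r, Q r.
  exists 0%N; apply/asboolP; exists 0; split; last exact: mxrank0.
  by move=> v; rewrite submx0 => /eqP ->.
have leQ r : Q r -> (r <= d)%N by case/asboolP=> A [_ <-]; exact: rank_leq_row.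
case: (ex_maxnP exQ leQ) => r /asboolP[A [PA rA]] maxr.
exists A => v; split=> [Pv|]; last exact: PA.
apply: contraPT Pv => vA Pv.
have inAv : inP (A + v)%MS.
  move=> w /sub_addsmxP[[u1 u2] /= ->]; apply: PD; first exact/PA/submxMl.
  have /sub_rVP[a ->] : (u2 *m v <= v)%MS by exact: submxMl.
  exact: PZ.
have : Q (\rank (A + v)%MS) by apply/asboolP; exists (A + v)%MS.
move/maxr; rewrite -rA leqNgt => /negP; apply.
rewrite ltn_neqAle mxrankS ?addsmxSl // andbT; apply: contra vA => /eqP rAv.
have := mxrank_leqif_sup (addsmxSl A v); case=> _; rewrite rAv eqxx.
by move/esym; rewrite addsmx_sub => /andP[].
Qed.

Lemma ksubspace_ker M N (V : set M) (f : M -> N) :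
  ksubspace V -> klinear f -> ksubspace (V `&` [set v | f v = 0]).
Proof.
move=> [V0 VD VZ] fL; have [fD fZ] := fL; split=> /=.
- by split=> //=; apply: klinear0.
- by move=> u v [Vu fu] [Vv fv]; split; [exact: VD | rewrite /= fD fu fv addr0].
- by move=> a v [Vv fv]; split; [exact: VZ | rewrite /= fZ fv scaler0].
Qed.

Lemma ksubspace_im M N (V : set M) (f : M -> N) :
  ksubspace V -> klinear f -> ksubspace (f @` V).
Proof.
move=> [V0 VD VZ] fL; have [fD fZ] := fL; split=> /=.
- by exists 0 => //; apply: klinear0.
- by move=> _ _ [u Vu <-] [v Vv <-]; exists (u + v); [exact: VD | rewrite fD].
- by move=> a _ [v Vv <-]; exists (a%:MP *: v); [exact: VZ | rewrite fZ].
Qed.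

(** In coordinates on [V] the kernel of [f] is the row space of a matrix [A];
    the rows of a complement of [A] map to a basis of the image. *)
Lemma rank_nullity M N (V : set M) (f : M -> N) d :
    ksubspace V -> klinear f -> hasdim V d ->
  exists e, [/\ (e <= d)%N, hasdim (V `&` [set v | f v = 0]) e
              & hasdim (f @` V) (d - e)].
Proof.
move=> VS fL [b /(kbasisP b VS)[Vb bgen bfree]].
have [|u v|a v|A kerA] := @subspace_rowspace d (fun c => f (kcomb b c) = 0).
- by rewrite kcomb0; apply: klinear0.
- by rewrite kcombD fL.1 => -> ->; rewrite addr0.
- by rewrite kcombZ fL.2 => ->; rewrite scaler0.
exists (\rank A); split; first exact: rank_leq_row.
- exists (fun i => kcomb b (row i (row_base A))).
  apply/(kbasisP _ (ksubspace_ker VS fL)); split=> [l|v [Vv fv]|c].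
  + split; first exact: ksubspace_kcomb.
    by apply/kerA; rewrite (submx_trans (row_sub _ _)) ?eq_row_base.
  + have [c cv] := bgen v Vv; move: fv; rewrite /= cv => /kerA.
    rewrite -(eq_row_base A) => /submxP[x ->].
    by exists x; rewrite kcomb_mulmx.
  + rewrite -kcomb_mulmx => /bfree /eqP.
    by rewrite mulmx_free_eq0 ?row_base_free // => /eqP.
- rewrite -mxrank_compl.
  exists (fun i => f (kcomb b (row i (row_base A^C%MS)))).
  apply/(kbasisP _ (ksubspace_im VS fL)); split=> [l|_ [v Vv <-]|c].
  + by exists (kcomb b (row l (row_base A^C%MS))); [apply: ksubspace_kcomb|].
  + have [c ->] := bgen v Vv.
    have /sub_addsmxP[[u1 u2] /= ->] : (c <= A + A^C)%MS.
      by rewrite submx_full // addsmx_compl_full.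
    have : (u2 *m A^C <= row_base A^C)%MS by rewrite eq_row_base submxMl.
    case/submxP=> x ->; exists x; rewrite kcombD fL.1.
    have /kerA-> : (u1 *m A <= A)%MS by exact: submxMl.
    by rewrite add0r kcomb_mulmx klinear_kcomb.
  + rewrite -[kcomb _ _](@klinear_kcomb _ _ _ _ f) // -kcomb_mulmx => /kerA cA.
    have : (c *m row_base A^C%MS <= A :&: A^C)%MS.
      by rewrite sub_capmx cA -(eq_row_base A^C%MS) submxMl.
    rewrite capmx_compl submx0 mulmx_free_eq0 ?row_base_free //.
    by move/eqP.
Qed.

End KSubspaces.

(** * Homogeneous components of polynomials *)

Lemma sum_if_eq (V : nmodType) (I : eqType) (r : seq I) (i : I) (x : V) :
  uniq r -> \sum_(j <- r) (if j == i then x else 0) = if i \in r then x else 0.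
Proof.
move=> ur; case: ifPn => ir.
  rewrite (bigD1_seq i) //= eqxx big1 ?addr0 // => j /negbTE ->.
  by [].
rewrite big_seq big1 // => j jr; case: eqP => // ji.
by rewrite -ji jr in ir.
Qed.

Section Homogeneous.

Variables (k : fieldType) (n : nat).
Implicit Types (p q : {mpoly k[n]}) (m : 'X_{1..n}) (d e : int).

Definition mrestrict (P : pred 'X_{1..n}) p : {mpoly k[n]} :=
  \sum_(m <- msupp p | P m) p@_m *: 'X_[m].

Lemma mcoeff_mrestrict P p m :
  (mrestrict P p)@_m = if P m then p@_m else 0.
Proof.
rewrite /mrestrict (big_morph (mcoeff m) (mcoeffD m) (mcoeff0 _ m)).
rewrite big_mkcond (eq_bigr (fun m' =>
    if m' == m then (if P m then p@_m else 0) else 0)); last first.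
  move=> m' _; rewrite mcoeffZ mcoeffX.
  by case: eqP => [->|_]; rewrite ?mulr1 ?mulr0 ?if_same.
rewrite sum_if_eq ?msupp_uniq //.
case: ifPn => //; rewrite -mcoeff_eq0 => /eqP ->.
by rewrite if_same.
Qed.

Lemma zhomogP d p :
  zhomog d p <-> forall m, p@_m != 0 -> (mdeg m)%:Z = d.
Proof.
case: d => d /=; split.
- by move=> /dhomogP hp m; rewrite -mcoeff_msupp => /hp ->.
- by move=> hp; apply/dhomogP => m; rewrite mcoeff_msupp => /hp[].
- by move=> -> m; rewrite mcoeff0 eqxx.
- move=> hp; apply/mpolyP => m; rewrite mcoeff0.
  by apply/eqP; apply: contraT => /hp.
Qed.

Lemma zhomog0 d : zhomog d (0 : {mpoly k[n]}).
Proof. by apply/zhomogP => m; rewrite mcoeff0 eqxx. Qed.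

Lemma zhomogD d p q : zhomog d p -> zhomog d q -> zhomog d (p + q).
Proof.
case: d => d /=; first exact: dhomogD.
by move=> -> ->; rewrite addr0.
Qed.

Lemma zhomogM d e p q : zhomog d p -> zhomog e q -> zhomog (d + e) (p * q).
Proof.
case: d => [d|d] hp; last by rewrite [p]hp mul0r => _; apply: zhomog0.
case: e => [e|e] hq; last by rewrite [q]hq mulr0; apply: zhomog0.
exact: dhomogM.
Qed.

Lemma zhomogC (c : k) : zhomog 0 (c%:MP : {mpoly k[n]}).
Proof.
apply/zhomogP => m; rewrite mcoeffC; case: (m =P 0%MM) => [->|_]; first by rewrite mdeg0.
by rewrite mulr0 eqxx.
Qed.

Lemma zhomogCM d (c : k) p : zhomog d p -> zhomog d (c%:MP * p).
Proof. by move=> hp; rewrite -[d]add0r; apply: zhomogM => //; apply: zhomogC. Qed.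

Definition zcomp d p := mrestrict (fun m => (mdeg m)%:Z == d) p.

Lemma mcoeff_zcomp d p m :
  (zcomp d p)@_m = if (mdeg m)%:Z == d then p@_m else 0.
Proof. exact: mcoeff_mrestrict. Qed.

Lemma zcomp_zhomog d p : zhomog d (zcomp d p).
Proof.
apply/zhomogP => m; rewrite mcoeff_zcomp; case: ifP => [/eqP //|_].
by rewrite eqxx.
Qed.

Lemma zcomp_id d p : zhomog d p -> zcomp d p = p.
Proof.
move=> /zhomogP hp; apply/mpolyP => m; rewrite mcoeff_zcomp.
case: eqP => // md; have [//|/hp/md[]] := eqVneq p@_m 0.
Qed.

Lemma zcomp_ne d e p : zhomog e p -> d != e -> zcomp d p = 0.
Proof.
move=> /zhomogP hp de; apply/mpolyP => m; rewrite mcoeff_zcomp mcoeff0.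
case: eqP => // md; apply/eqP; apply: contraNT de => /hp <-.
by rewrite md.
Qed.

Lemma zcompD d p q : zcomp d (p + q) = zcomp d p + zcomp d q.
Proof.
apply/mpolyP => m; rewrite mcoeffD !mcoeff_zcomp mcoeffD.
by case: ifP => // _; rewrite addr0.
Qed.

Lemma zcomp0 d : zcomp d 0 = 0.
Proof. by apply/mpolyP => m; rewrite mcoeff_zcomp mcoeff0 if_same. Qed.

Lemma zcomp_sum d I (r : seq I) (P : pred I) (F : I -> {mpoly k[n]}) :
  zcomp d (\sum_(i <- r | P i) F i) = \sum_(i <- r | P i) zcomp d (F i).
Proof. exact: (big_morph (zcomp d) (zcompD d) (zcomp0 d)). Qed.

(** Multiplication by a homogeneous polynomial of degree [e] shifts components;
    by linearity it suffices to look at a monomial times [q], which is itself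
    homogeneous. *)
Lemma zcompM d e p q : zhomog e q -> zcomp (d + e) (p * q) = zcomp d p * q.
Proof.
move=> hq; rewrite [in LHS](mpolyE p) mulr_suml zcomp_sum /zcomp /mrestrict.
rewrite mulr_suml [in RHS]big_mkcond; apply: eq_bigr => m _ /=.
rewrite -/(zcomp _ _).
have hm : zhomog ((mdeg m)%:Z + e) (p@_m *: 'X_[m] * q).
  by apply: zhomogM => //; rewrite -mul_mpolyC; apply: zhomogCM; rewrite /= dhomogX.
case: eqP => [<-|/eqP md]; first exact: zcomp_id.
by apply: zcomp_ne hm _; rewrite (inj_eq (addIr e)) eq_sym.
Qed.

End Homogeneous.

(** * The Hilbert function of the polynomial ring *)

Definition monomials (n : nat) (d : int) : seq 'X_{1..n} :=
  if d is Posz e then [seq s2m (val t) | t <- enum (basis n e)] else [::].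

Lemma mem_monomials n d (m : 'X_{1..n}) :
  (m \in monomials n d) = ((mdeg m)%:Z == d).
Proof. by case: d => d //=; rewrite -basis_cover. Qed.

Lemma monomials_uniq n d : uniq (monomials n d).
Proof. by case: d => d //=; apply: uniq_basis. Qed.

(** The polynomial of degree [n - 1] that takes the value
    [binomial (d + n - 1) (n - 1)] at [d >= 0]; it is zero when [n = 0]. *)
Definition monomials_poly (n : nat) : {poly rat} :=
  if n is m.+1 then (m`!%:R)^-1 *: \prod_(i < m) ('X + (i.+1)%:R%:P) else 0.

Lemma horner_monomials_poly n (x : rat) : (monomials_poly n.+1).[x] =
  (n`!%:R)^-1 * \prod_(i < n) (x + i.+1%:R).
Proof.
rewrite /monomials_poly hornerZ horner_prod; congr (_ * _).
by apply: eq_bigr => i _; rewrite hornerD hornerX hornerC.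
Qed.

Lemma prod_succ_fact n d :
  (d`! * \prod_(i < n) (d + i.+1))%N = (d + n)`!.
Proof.
elim: n => [|n IHn]; first by rewrite big_ord0 muln1 addn0.
by rewrite big_ord_recr /= mulnA IHn addnS factS mulnC.
Qed.

Lemma monomials_polyE n d : - n%:Z < d ->
  (size (monomials n d))%:R = (monomials_poly n).[d%:~R].
Proof.
case: n => [|n].
  rewrite horner0; case: d => [[|d]|d] // _; apply/eqP; rewrite pnatr_eq0 size_eq0.
  case E: (monomials 0 d.+1) => [//|m s].
  have : m \in monomials 0 d.+1 by rewrite E mem_head.
  by rewrite mem_monomials mdegE big_ord0.
rewrite horner_monomials_poly; case: d => d.
  move=> _; rewrite [monomials _ _]/= size_basis -pmulrn.
  have fact0 m : (m`!%:R : rat) != 0 by rewrite pnatr_eq0 -lt0n fact_gt0.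
  apply: (mulfI (fact0 n)); rewrite mulrA divff // mul1r.
  apply: (mulfI (fact0 d)).
  rewrite (eq_bigr (fun i : 'I_n => (d + i.+1)%:R)) => [|i _]; last by rewrite natrD.
  rewrite -natr_prod -!natrM prod_succ_fact -(bin_fact (leq_addr n d)) addKn.
  by congr (_%:R); rewrite mulnA mulnC.
move=> dn; rewrite [monomials _ _]/=.
have ltdn : (d < n)%N by move: dn; rewrite NegzE; lia.
rewrite (bigD1 (Ordinal ltdn)) //= NegzE mulrNz -pmulrn addNr.
by rewrite mul0r mulr0.
Qed.

(** At [d = - n] the polynomial is [(-1)^(n-1)], while no monomial has negative
    degree; for [n = 0] it is the polynomial that vanishes. *)
Lemma monomials_poly_opp n :
  (size (monomials n (- n%:Z)))%:R != (monomials_poly n).[(- n%:Z)%:~R].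
Proof.
case: n => [|n].
  rewrite horner0 pnatr_eq0 size_eq0 oppr0; apply/eqP => m0.
  by have := mem_monomials 0 (0%MM : 'X_{1..0}); rewrite m0 mdeg0.
rewrite horner_monomials_poly -NegzE eq_sym mulf_neq0 //.
  by rewrite invr_eq0 pnatr_eq0 -lt0n fact_gt0.
apply/prodf_neq0 => i _; rewrite NegzE mulrNz -pmulrn addrC subr_eq0 eqr_nat.
by have := ltn_ord i; lia.
Qed.

(** * Hilbert functions from graded resolutions *)

Section GradedFree.

Variables (k : fieldType) (n : nat).

Definition graded_piece r (e : 'I_r -> int) (s : int) : set 'rV[{mpoly k[n]}]_r :=
  [set u | forall l, zhomog (s - e l) (u 0 l)].

Lemma ksubspace_graded_piece r (e : 'I_r -> int) s :
  ksubspace (graded_piece e s).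
Proof.
split=> [l|u v hu hv l|a v hv l]; rewrite mxE; first exact: zhomog0.
  by apply: zhomogD; [exact: hu | exact: hv].
exact/zhomogCM/hv.
Qed.

(** The basis consists of the monomials of degree [s - e l] placed in coordinate
    [l]; the dual functionals read off their coefficients. *)
Lemma hasdim_graded_piece r (e : 'I_r -> int) s :
  hasdim (graded_piece e s) (\sum_l size (monomials n (s - e l))).
Proof.
pose T := {l : 'I_r & seq_sub (monomials n (s - e l))}.
have -> : (\sum_l size (monomials n (s - e l)))%N = #|{: T}|.
  rewrite card_tagged sumnE big_map big_enum /=; apply: eq_bigr => l _.
  by rewrite card_seq_sub ?monomials_uniq.
pose mon (t : T) : 'X_{1..n} := ssval (tagged t).
have mon_mem t : (mdeg (mon t))%:Z = s - e (tag t).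
  by apply/eqP; rewrite -mem_monomials; exact: ssvalP.
apply: (@hasdim_dual _ _ _ _ _
  (fun t => 'X_[mon t] *: delta_mx 0 (tag t))
  (fun t u => (u 0 (tag t))@_(mon t))).
- exact: ksubspace_graded_piece.
- move=> t l; rewrite !mxE eqxx /=; case: eqP => [->|_].
    by rewrite mulr1 -mon_mem /= dhomogX.
  by rewrite mulr0; apply: zhomog0.
- by move=> t u v; rewrite mxE mcoeffD.
- by move=> t a v; rewrite mxE mcoeffCM.
- move=> t t'; rewrite !mxE eqxx /=.
  case: (tag t =P tag t') => tt'; last first.
    by rewrite mulr0 mcoeff0; case: eqP => // tt; rewrite tt in tt'.
  rewrite mulr1 mcoeffX; congr ((nat_of_bool _)%:R).
  apply/eqP/eqP => [|->//]; case: t t' tt' => l x [l' x'] /= ll'.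
  subst l'; rewrite /mon /= => xx'; congr (Tagged _ _).
  exact/esym/val_inj.
- move=> v hv v0; apply/rowP => l; rewrite mxE; apply/mpolyP => m.
  rewrite mcoeff0; apply/eqP; apply: contraT => vm.
  have mm : m \in monomials n (s - e l).
    by rewrite mem_monomials; apply/eqP; have /zhomogP := hv l; apply.
  have := v0 (Tagged (fun l => seq_sub (monomials n (s - e l))) (SeqSub mm)).
  by rewrite /mon /= => vm0; rewrite vm0 eqxx in vm.
Qed.

Definition zcomp_row r (e : 'I_r -> int) s (u : 'rV[{mpoly k[n]}]_r) :
    'rV[{mpoly k[n]}]_r :=
  \row_l zcomp (s - e l) (u 0 l).

Lemma zcomp_row_piece r (e : 'I_r -> int) s u :
  graded_piece e s (zcomp_row e s u).
Proof. by move=> l; rewrite mxE; apply: zcomp_zhomog. Qed.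

Lemma zcomp_row_id r (e : 'I_r -> int) s u :
  graded_piece e s u -> zcomp_row e s u = u.
Proof. by move=> hu; apply/rowP => l; rewrite mxE zcomp_id. Qed.

Section HomogeneousMatrix.

Variables (r r' : nat) (e : 'I_r -> int) (e' : 'I_r' -> int).
Variables (A : 'M[{mpoly k[n]}]_(r, r')).
Hypothesis A_homog : forall l m, zhomog (e l - e' m) (A l m).

(** Taking components commutes with homogeneous matrices, so a preimage of a
    homogeneous row may be replaced by its component of the same degree. *)
Lemma zcomp_row_mulmx s w :
  zcomp_row e' s (w *m A) = zcomp_row e s w *m A.
Proof.
apply/rowP => m; rewrite !mxE zcomp_sum; apply: eq_bigr => l _.
by rewrite mxE -(zcompM _ _ (A_homog l m)) addrA subrK.
Qed.

Lemma graded_piece_mulmx s w :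
  graded_piece e s w -> graded_piece e' s (w *m A).
Proof.
by move=> hw; rewrite -(zcomp_row_id hw) -zcomp_row_mulmx; apply: zcomp_row_piece.
Qed.

End HomogeneousMatrix.

Section Presentation.

Variables (M : lmodType {mpoly k[n]}) (G : grading M).

Lemma gradedZ d t (p : {mpoly k[n]}) v :
  zhomog d p -> G t v -> G (t + d) (p *: v).
Proof.
case: d => d hp Gv; first exact: compZ.
by rewrite [p]hp scale0r; apply: comp0.
Qed.

Lemma ksubspace_comp s : ksubspace (G s).
Proof.
split=> [|u v|a v Gv]; [exact: comp0 | exact: compD |].
by rewrite -[s]addr0; apply: gradedZ Gv; apply: zhomogC.
Qed.

Lemma comp_sum s I (r : seq I) (P : pred I) (f : I -> M) :
  (forall i, P i -> G s (f i)) -> G s (\sum_(i <- r | P i) f i).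
Proof. by move=> Gf; apply: big_ind => //; [exact: comp0 | exact: compD]. Qed.

Variables (r : nat) (e : 'I_r -> int) (g : 'I_r -> M).
Hypothesis g_homog : forall l, G (e l) (g l).

Let eval (u : 'rV[{mpoly k[n]}]_r) : M := \sum_l u 0 l *: g l.

Lemma eval_klinear : klinear eval.
Proof.
split=> [u v|a u]; rewrite /eval.
  by rewrite -big_split; apply: eq_bigr => l _; rewrite mxE scalerDl.
by rewrite scaler_sumr; apply: eq_bigr => l _; rewrite mxE scalerA.
Qed.

Lemma eval_piece s u : graded_piece e s u -> G s (eval u).
Proof.
move=> hu; apply: comp_sum => l _; rewrite -[s](subrKC (e l)).
exact: gradedZ.
Qed.

(** The values of [eval] at the homogeneous components of [u] decompose
    [eval u]; independence of the [G t] identifies the component of degree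
    [s]. *)
Lemma eval_zcomp_row s u : G s (eval u) -> eval (zcomp_row e s u) = eval u.
Proof.
move=> Gu.
(* The degrees of all terms occurring in [u], together with [s]. *)
pose ts := undup (s :: flatten
  [seq [seq (mdeg m)%:Z + e l | m <- msupp (u 0 l)] | l <- enum 'I_r]).
have uts : uniq ts by exact: undup_uniq.
have sts : s \in ts by rewrite mem_undup mem_head.
have compts l : u 0 l = \sum_(t <- ts) zcomp (t - e l) (u 0 l).
  apply/mpolyP => m.
  rewrite (big_morph (mcoeff m) (mcoeffD m) (mcoeff0 _ m)).
  under eq_bigr => t _ do rewrite mcoeff_zcomp eq_sym subr_eq.
  rewrite sum_if_eq //; case: ifPn => // mts.
  apply/eqP; apply: contraNT mts; rewrite -mcoeff_msupp => mu.
  rewrite mem_undup inE; apply/orP; right; apply/flattenP.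
  exists [seq (mdeg m)%:Z + e l | m <- msupp (u 0 l)]; last exact: map_f.
  by apply/mapP; exists l; rewrite ?mem_enum.
have decomp : eval u = \sum_(t <- ts) eval (zcomp_row e t u).
  rewrite /eval exchange_big; apply: eq_bigr => l _ /=.
  rewrite [in LHS]compts scaler_suml.
  by apply: eq_bigr => t _; rewrite mxE.
pose f t := eval (zcomp_row e t u) - (if t == s then eval u else 0).
have Gf t : G t (f t).
  have [_ GD GZ] := ksubspace_comp t.
  apply: GD; first exact/eval_piece/zcomp_row_piece.
  case: eqP => [->|_]; last by rewrite oppr0; apply: comp0.
  have [_ _ /(_ (- 1) _ Gu)] := ksubspace_comp s.
  by rewrite mpolyCN mpolyC1 scaleN1r.
have f0 : \sum_(t <- ts) f t = 0.
  by rewrite sumrB -decomp sum_if_eq // sts subrr.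
have := comp_indep uts Gf f0 sts.
by rewrite /f eqxx => /eqP; rewrite subr_eq0 => /eqP.
Qed.

End Presentation.

End GradedFree.

Section HilbertFunctionOfResolution.

Variables (k : fieldType) (n : nat) (M : lmodType {mpoly k[n]}).
Variables (G : grading M) (F : min_free_resolution G) (s : int).

Let V i : set 'rV[{mpoly k[n]}]_(rk F i) :=
  graded_piece (@fdeg _ _ _ _ F i) s.
Arguments V : clear implicits.

Let N i : nat := \sum_(l < rk F i) size (monomials n (s - fdeg l)).

Let eval (u : 'rV[{mpoly k[n]}]_(rk F 0)) : M := \sum_l u 0 l *: aug l.

Let syz i : set 'rV[{mpoly k[n]}]_(rk F i) :=
  match i with
  | 0%N => V 0 `&` [set u | eval u = 0]
  | i.+1 => V i.+1 `&` [set u | u *m dif F i = 0]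
  end.
Arguments syz : clear implicits.

Lemma eval_graded_image : eval @` V 0 = G s.
Proof.
apply/seteqP; split=> [_ [u hu <-]|v Gv].
  exact: (eval_piece (@aug_homog _ _ _ _ F) hu).
have [u uv] := aug_surj F v.
exists (zcomp_row (@fdeg _ _ _ _ F 0) s u); first exact: zcomp_row_piece.
by rewrite [LHS](eval_zcomp_row (@aug_homog _ _ _ _ F)) -uv.
Qed.

Lemma dif_graded_image i : (fun u => u *m dif F i) @` V i.+1 = syz i.
Proof.
apply/seteqP; split=> [_ [u hu <-]|u].
  have Vu : V i (u *m dif F i) by exact: graded_piece_mulmx (@dif_homog _ _ _ _ F i) _ _ hu.
  case: i u hu Vu => [|i] u hu Vu; split=> //=.
    by apply/aug_exact; exists u.
  by apply/dif_exact; exists u.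
have preim w : V i u -> u = w *m dif F i ->
    ((fun u => u *m dif F i) @` V i.+1) u.
  move=> Vu uw; exists (zcomp_row (@fdeg _ _ _ _ F i.+1) s w).
    exact: zcomp_row_piece.
  by rewrite /= -(zcomp_row_mulmx (@dif_homog _ _ _ _ F i)) -uw zcomp_row_id.
case: i u preim => [|i] u preim [Vu /=].
  by move/aug_exact=> [w /preim]; apply.
by move/dif_exact=> [w /preim]; apply.
Qed.

Lemma mulmx_klinear i :
  klinear (fun u : 'rV[{mpoly k[n]}]_(rk F i.+1) => u *m dif F i).
Proof. by split=> [u v|a u]; rewrite ?mulmxDl ?scalemxAl. Qed.

Lemma ksubspace_syz i : ksubspace (syz i).
Proof.
rewrite -dif_graded_image; apply: ksubspace_im; last exact: mulmx_klinear.
exact: ksubspace_graded_piece.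
Qed.

Lemma hasdim_syz0 : exists z, [/\ (z <= N 0)%N, hasdim (syz 0) z
  & hasdim (G s) (N 0 - z)].
Proof.
have [z [zN hz him]] := rank_nullity
  (ksubspace_graded_piece _ _ _ s) (eval_klinear (@aug _ _ _ _ F))
  (hasdim_graded_piece k n (@fdeg _ _ _ _ F 0) s).
exists z; split=> //.
by rewrite -/eval -/(V 0) eval_graded_image in him.
Qed.

Lemma hasdim_comp : hasdim (G s) (hilbert_function G s).
Proof.
have [z [_ _ hG]] := hasdim_syz0.
by rewrite /hilbert_function (kdimE (ksubspace_comp G s) hG).
Qed.

(** Splitting the strand of degree [s] into short exact sequences
    [0 -> syz (i+1) -> V (i+1) -> syz i -> 0]. *)
Lemma hilbert_function_syz m : exists z, hasdim (syz m) z /\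
  (hilbert_function G s)%:Z =
    \sum_(i < m.+1) (-1) ^+ i * (N i)%:Z + (-1) ^+ m.+1 * z%:Z.
Proof.
elim: m => [|m [z [hz Hs]]].
  have [z [zN hz hG]] := hasdim_syz0.
  exists z; split=> //.
  rewrite /hilbert_function (kdimE (ksubspace_comp G s) hG).
  by rewrite big_ord1 expr0 expr1 mul1r mulN1r -subzn.
have [z' [zN hz' him]] := rank_nullity
  (ksubspace_graded_piece _ _ _ s) (mulmx_klinear m)
  (hasdim_graded_piece k n (@fdeg _ _ _ _ F m.+1) s).
exists z'; split=> //; rewrite -/(V m.+1) dif_graded_image -/(N m.+1) in him.
have zz : z = (N m.+1 - z')%N.
  by apply/eqP; rewrite eqn_leq !(hasdim_leq (ksubspace_syz m)).
rewrite big_ord_recr /= Hs zz -subzn // [(-1) ^+ m.+2]exprSr mulrN1 mulNr.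
by rewrite mulrBr addrA.
Qed.

(** Euler characteristic: the last term of the exact strand of degree [s]
    contributes nothing once the resolution has stopped. *)
Lemma hilbert_function_resolution m : rk F m.+1 = 0%N ->
  (hilbert_function G s)%:Z = \sum_(i < m.+1) (-1) ^+ i * (N i)%:Z.
Proof.
move=> rk0; have [z [hz ->]] := hilbert_function_syz m.
have [z' [_ _ him]] := rank_nullity
  (ksubspace_graded_piece _ _ _ s) (mulmx_klinear m)
  (hasdim_graded_piece k n (@fdeg _ _ _ _ F m.+1) s).
rewrite -/(V m.+1) dif_graded_image in him.
have N0 : N m.+1 = 0%N.
  rewrite /N big1 // => l _.
    by have : (l < 0)%N by rewrite -[X in (_ < X)%N]rk0.
have := hasdim_leq (ksubspace_syz m) hz him.
by rewrite -/(N m.+1) N0 leqn0 => /eqP ->; rewrite mulr0 addr0.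
Qed.

End HilbertFunctionOfResolution.

(** * The length of a minimal resolution *)

Section Length.

Variables (k : fieldType) (n : nat).
Implicit Types (p q : {mpoly k[n]}) (m : 'X_{1..n}).

Definition avoids (t : nat) m : bool := [forall i : 'I_n, (i < t)%N ==> (m i == 0%N)].

(** Membership in the ideal generated by the variables of index below [t]:
    every monomial of [p] involves one of them. *)
Definition in_vars t p : Prop := forall m, avoids t m -> p@_m = 0.

Lemma avoidsD t m m' : avoids t (m + m') = avoids t m && avoids t m'.
Proof.
apply/forallP/andP => [h|[/forallP h /forallP h'] i]; last first.
  apply/implyP => it; rewrite mnmDE addn_eq0.
  by rewrite (implyP (h i) it) (implyP (h' i) it).
by split; apply/forallP => i; apply/implyP => it;
  have := implyP (h i) it; rewrite mnmDE addn_eq0 => /andP[].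
Qed.

Lemma avoidsS (t : 'I_n) m : avoids t.+1 m = avoids t m && (m t == 0%N).
Proof.
apply/forallP/andP => [h|[/forallP h mt] i].
  split; last by apply: implyP (h t) _.
  by apply/forallP => i; apply/implyP => it; apply: implyP (h i) (ltnW _).
apply/implyP; rewrite ltnS leq_eqVlt => /orP[/eqP/val_inj -> //|].
exact/implyP.
Qed.

Lemma avoidsU t (j : 'I_n) : (t <= j)%N -> avoids t U_(j)%MM.
Proof.
move=> tj; apply/forallP => i; apply/implyP => it; rewrite mnm1E.
by case: (j =P i) => // ji; move: it; rewrite -ji ltnNge tj.
Qed.

Lemma avoids_all m : avoids n m = (m == 0%MM).
Proof.
apply/forallP/eqP => [h|-> i]; last by rewrite mnm0E eqxx implybT.
by apply/mnmP => i; rewrite mnm0E; apply/eqP/(implyP (h i)).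
Qed.

Lemma in_vars0P p : in_vars 0 p <-> p = 0.
Proof.
split=> [h|-> m _]; last by rewrite mcoeff0.
by apply/mpolyP => m; rewrite mcoeff0 h //; apply/forallP => i.
Qed.

Lemma in_varsD t p q : in_vars t p -> in_vars t q -> in_vars t (p + q).
Proof. by move=> hp hq m am; rewrite mcoeffD hp ?hq ?addr0. Qed.

Lemma in_varsN t p : in_vars t p -> in_vars t (- p).
Proof. by move=> hp m am; rewrite mcoeffN hp ?oppr0. Qed.

Lemma in_varsM t p q : in_vars t q -> in_vars t (p * q).
Proof.
move=> hq m am; rewrite mcoeffM big1 // => -[m1 m2] /= /eqP mE.
have : avoids t (m1 + m2)%MM by rewrite -mE.
by rewrite avoidsD => /andP[_ am2]; rewrite hq ?mulr0.
Qed.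

Lemma in_varsW (t : 'I_n) p : in_vars t p -> in_vars t.+1 p.
Proof. by move=> hp m; rewrite avoidsS => /andP[am _]; apply: hp. Qed.

Lemma in_varsX (t : 'I_n) p : in_vars t.+1 ('X_t * p).
Proof.
rewrite mulrC; apply: in_varsM => m; rewrite avoidsS => /andP[_ mt].
by rewrite mcoeffX; case: (_ =P m) => // mE; move: mt; rewrite -mE mnm1E eqxx.
Qed.

(** The variables form a regular sequence. *)
Lemma in_vars_regular (t : 'I_n) p : in_vars t ('X_t * p) -> in_vars t p.
Proof.
move=> hp m am; rewrite -(mcoeffMX p U_(t) m) mulrC; apply: hp.
by rewrite avoidsD avoidsU.
Qed.

Lemma in_varsS (t : 'I_n) p :
  in_vars t.+1 p -> exists q, in_vars t (p - 'X_t * q).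
Proof.
move=> hp.
(* The terms of [p] divisible by ['X_t], divided by ['X_t]. *)
exists (\sum_(m <- msupp p | m t != 0%N) p@_m *: 'X_[m - U_(t)]) => m am.
rewrite mulr_sumr (eq_bigr (fun m => p@_m *: 'X_[m])) => [|m' m't]; last first.
  rewrite -scalerAr -mpolyXD addmC submK //; apply/mnm_lepP => i.
  by rewrite mnm1E; case: (t =P i) => // <-; rewrite lt0n.
rewrite -/(mrestrict _ _) mcoeffB mcoeff_mrestrict.
case: eqP => /= mt; last by rewrite subrr.
by rewrite subr0 hp // avoidsS am mt eqxx.
Qed.

Definition row_in_vars t r (u : 'rV[{mpoly k[n]}]_r) : Prop :=
  forall j, in_vars t (u 0 j).

Lemma row_in_varsD t r (u v : 'rV_r) :
  row_in_vars t u -> row_in_vars t v -> row_in_vars t (u + v).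
Proof. by move=> hu hv j; rewrite mxE; apply: in_varsD. Qed.

Lemma row_in_varsN t r (u : 'rV_r) : row_in_vars t u -> row_in_vars t (- u).
Proof. by move=> hu j; rewrite mxE; apply: in_varsN. Qed.

Lemma row_in_varsM t r r' (u : 'rV_r) (A : 'M_(r, r')) :
  row_in_vars t u -> row_in_vars t (u *m A).
Proof.
move=> hu j m am; rewrite mxE (big_morph (mcoeff m) (mcoeffD m) (mcoeff0 _ m)).
by rewrite big1 // => i _; rewrite mulrC (in_varsM _ (hu i)).
Qed.

Lemma row_in_varsS (t : 'I_n) r (u : 'rV_r) :
  row_in_vars t.+1 u -> exists v, row_in_vars t (u - 'X_t *: v).
Proof.
move=> hu; have /choice[q hq] j := in_varsS (hu j).
by exists (\row_j q j) => j; rewrite !mxE.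
Qed.

Variables (M : lmodType {mpoly k[n]}) (G : grading M).
Variables (F : min_free_resolution G).

(** Tensoring the resolution with the quotient by the first [t] variables keeps
    it exact from position [t + 1] on: a relation modulo one more variable
    ['X_t] is pulled back one step, where ['X_t] can be cancelled. *)
Lemma exact_mod_vars t i (u : 'rV_(rk F i.+1)) : (t <= n)%N -> (t <= i)%N ->
  row_in_vars t (u *m dif F i) -> exists w, row_in_vars t (u - w *m dif F i.+1).
Proof.
elim: t i u => [|t IHt] i u tn ti.
  move=> hu; have /dif_exact[w ->] : u *m dif F i = 0.
    by apply/rowP => j; rewrite [RHS]mxE; apply/in_vars0P.
  by exists w; rewrite subrr => j; rewrite mxE; apply/in_vars0P.
case: i u ti => // i u; rewrite ltnS => ti.
have t_lt : (t < n)%N by []; pose j := Ordinal t_lt.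
move=> /(row_in_varsS (t := j))[v hv].
have hvd : row_in_vars t (v *m dif F i).
  move=> l; apply: (in_vars_regular (t := j)).
  have := row_in_varsN (row_in_varsM (dif F i) hv) l.
  rewrite mulmxBl -mulmxA -scalemxAl.
  have -> : u *m (dif F i.+1 *m dif F i) = 0.
    by rewrite mulmxA; apply/dif_exact; exists u.
  by rewrite sub0r opprK mxE.
have [w hw] := IHt i v (ltnW tn) ti hvd.
have huw : row_in_vars t ((u - 'X_j *: w) *m dif F i.+1).
  have := row_in_varsD hv (row_in_varsM (('X_j)%:M) hw).
  rewrite mul_mx_scalar scalerBr mulmxBl -scalemxAl.
  by rewrite addrA subrK.
have [w' hw'] := IHt i.+1 (u - 'X_j *: w) (ltnW tn) (leqW ti) huw.
exists w' => l; have := in_varsD (in_varsW (t := j) (hw' l)) (@in_varsX j (w 0 l)).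
by rewrite !mxE addrAC subrK.
Qed.

(** Modulo all variables a minimal resolution has zero differentials, so the
    exactness above leaves no room for a free generator beyond position [n]. *)
Lemma resolution_length i : (n < i)%N -> rk F i = 0%N.
Proof.
case: i => // i; rewrite ltnS => ni; apply/eqP; rewrite -leqn0 leqNgt.
apply/negP => rk_gt0; pose l := Ordinal rk_gt0.
(* The basis row at [l] is then a boundary up to the maximal ideal, but
   boundaries have coordinates without constant term. *)
have [j m|w hw] := exact_mod_vars (u := delta_mx 0 l) (leqnn n) ni.
  by rewrite avoids_all -rowE mxE => /eqP ->; apply: dif_minimal.
have := hw l 0%MM; rewrite avoids_all eqxx => /(_ isT) /eqP.
rewrite !mxE !eqxx mcoeffB mcoeff1 eqxx.
rewrite (big_morph (mcoeff 0%MM) (mcoeffD _) (mcoeff0 _ _)) big1 ?subr0 ?oner_eq0 //.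
by move=> j _; rewrite rmorphM /= dif_minimal mulr0.
Qed.

End Length.

(** * The numerical comparison *)

Lemma greatest_exists (A : set int) a b :
  A a -> ubound A b -> exists x, greatest A x.
Proof.
move=> Aa ubA.
have ab : a <= b by exact: ubA.
pose Q (m : nat) := `[< A (b - m%:Z) >].
have exQ : exists m, Q m.
  exists `|b - a|%N; apply/asboolP.
  by rewrite gez0_abs ?subr_ge0 // opprB addrC subrK.
case: (ex_minnP exQ) => m /asboolP Am minm; exists (b - m%:Z); split=> // x Ax.
have xb := ubA x Ax.
have /minm : Q `|b - x|%N.
  by apply/asboolP; rewrite gez0_abs ?subr_ge0 // opprB addrC subrK.
lia.
Qed.

Lemma least_unique (A : set int) x y : least A x -> least A y -> x = y.
Proof.
by move=> [Ax lx] [Ay ly]; apply/eqP; rewrite eq_le lx ?ly.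
Qed.

Lemma poly_eventually_eq (p q : {poly rat}) (s0 : int) :
  (forall s : int, s0 <= s -> p.[s%:~R] = q.[s%:~R]) -> p = q.
Proof.
move=> pq; apply/eqP; rewrite -subr_eq0; apply: contraT => d0.
pose rs := [seq (s0 + i%:Z)%:~R : rat | i <- iota 0 (size (p - q))].
have : all (root (p - q)) rs.
  apply/allP => _ /mapP[i _ ->]; rewrite rootE hornerD hornerN pq ?subrr //.
  lia.
move/(max_poly_roots d0); rewrite size_map size_iota ltnn; apply.
rewrite map_inj_uniq ?iota_uniq // => i j /eqP.
by rewrite eqr_int => /eqP /addrI [].
Qed.

Section Numerics.

Variables (k : fieldType) (n : nat) (M : lmodType {mpoly k[n]}).
Variables (G : grading M) (F : min_free_resolution G).
Hypothesis M_neq0 : exists v : M, v != 0.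

Let chi := alt_betti F.

Lemma betti_neq0 i j : betti F i j <> 0%N ->
  (i <= n)%N /\ exists l : 'I_(rk F i), fdeg l = j.
Proof.
move=> bij; split.
  rewrite leqNgt; apply/negP => /(resolution_length F) rk0; apply: bij.
  apply: eq_card0 => l.
  by have : (l < 0)%N by rewrite -[X in (_ < X)%N]rk0.
have [/pred0P b0|/pred0Pn[l /eqP lj]] :=
  boolP (pred0b [pred l : 'I_(rk F i) | fdeg l == j]).
  by case: bij; apply: eq_card0.
by exists l.
Qed.

Lemma alt_bettiE j : chi j = \sum_(i < n.+1) (-1) ^+ i * (betti F i j)%:Z.
Proof.
rewrite (fsbig_ord _ _ (fun i => (-1) ^+ i * (betti F i j)%:Z)).
apply/esym/fsbig_widen => // i [_ ni] /=.
have -> : betti F i j = 0%N; last by rewrite mulr0.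
apply/eqP; apply: contraT => /eqP /betti_neq0[ilen _].
by case: ni; rewrite /= ltnS.
Qed.

Lemma alt_betti_neq0 j : chi j <> 0 -> exists i, betti F i j <> 0%N.
Proof.
move=> cj; apply: contrapT => nb; apply: cj; rewrite alt_bettiE big1 // => i _.
suff -> : betti F i j = 0%N by rewrite mulr0.
by apply: contrapT => bij; apply: nb; exists i.
Qed.

(** All degrees of generators of the free modules [F_0, ..., F_n], hence of the
    whole resolution. *)
Definition degrees : seq int :=
  undup (flatten [seq [seq fdeg l | l <- enum 'I_(rk F i)] | i <- iota 0 n.+1]).

Lemma mem_degrees i (l : 'I_(rk F i)) : (i <= n)%N -> fdeg l \in degrees.
Proof.
move=> ilen; rewrite mem_undup; apply/flattenP.
exists [seq fdeg l | l <- enum 'I_(rk F i)].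
  by apply/mapP; exists i; rewrite // mem_iota.
by apply: map_f; rewrite mem_enum.
Qed.

(** Grouping generators of the same degree in the Euler characteristic of the
    strand of degree [s] leaves only the alternating sums of Betti numbers. *)
Lemma hilbert_function_alt_betti s : (hilbert_function G s)%:Z =
  \sum_(j <- degrees) chi j * (size (monomials n (s - j)))%:Z.
Proof.
rewrite (hilbert_function_resolution _ (resolution_length F (ltnSn n))).
transitivity (\sum_(i < n.+1) \sum_(j <- degrees)
  (-1) ^+ i * (betti F i j * size (monomials n (s - j)))%:Z).
  apply: eq_bigr => i _; rewrite -mulr_sumr -(big_morph Posz PoszD (erefl _)).
  congr (_ * Posz _).
  transitivity (\sum_(l < rk F i) \sum_(j <- degrees)
      if j == fdeg l then size (monomials n (s - fdeg l)) else 0)%N.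
    apply: eq_bigr => l _.
    by rewrite sum_if_eq ?undup_uniq // mem_degrees // -ltnS.
  rewrite exchange_big; apply: eq_bigr => j _ /=; rewrite -big_mkcond.
  rewrite (eq_bigr (fun=> size (monomials n (s - j)))) => [|l /eqP -> //].
  rewrite sum_nat_const; congr (_ * _)%N.
  by apply: eq_card => l; rewrite !inE eq_sym.
rewrite exchange_big; apply: eq_bigr => j _ /=.
rewrite alt_bettiE mulr_suml; apply: eq_bigr => i _.
by rewrite PoszM mulrA.
Qed.

(* The Hilbert polynomial of [M], as [hilbert_regularityE] shows. *)
Let P : {poly rat} := \sum_(j <- degrees)
  (chi j)%:~R *: (monomials_poly n \Po ('X - (j%:~R)%:P)).

(** Only the degrees [j] with [s - j <= - n] contribute to the difference,
    since elsewhere the monomials of degree [s - j] are counted by a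
    polynomial. *)
Lemma hilbert_function_sub s : (hilbert_function G s)%:R - P.[s%:~R] =
  \sum_(j <- degrees) (chi j)%:~R *
    ((size (monomials n (s - j)))%:R - (monomials_poly n).[(s - j)%:~R]).
Proof.
rewrite pmulrn hilbert_function_alt_betti.
rewrite (big_morph _ (intrD _) (mulr0z 1)) /P horner_sum -sumrB.
apply: eq_bigr => j _; rewrite hornerZ horner_comp hornerD hornerN hornerX hornerC.
by rewrite intrM mulrBr -pmulrn intrB.
Qed.

Lemma ubound_betti :
  exists b, ubound [set m | exists i j, betti F i j <> 0%N /\ m = j - i%:Z] b.
Proof.
exists (\sum_(j <- degrees) `|j|) => _ [i [j [bij ->]]].
have [ilen [l lj]] := betti_neq0 bij.
apply: le_trans (_ : `|j| <= _); first by have := ler_norm j; lia.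
rewrite (bigD1_seq j) ?undup_uniq //=; last by rewrite -lj mem_degrees.
by rewrite lerDl sumr_ge0.
Qed.

(** Were all alternating sums zero, the Hilbert function would vanish, and so
    would [M]. *)
Lemma alt_betti_exists : exists j, chi j <> 0.
Proof.
apply: contrapT => nchi.
have [v] := M_neq0; have [r [f [Gf ->]]] := comp_span G v.
rewrite big1 ?eqxx // => s _.
have H0 : hilbert_function G s = 0%N.
  have := hilbert_function_alt_betti s; rewrite big1 => [[]//|j _].
  have -> : chi j = 0; last by rewrite mul0r.
  by apply: contrapT => cj; apply: nchi; exists j.
by have := hasdim_comp F s; rewrite H0 => /hasdim0; apply; apply: Gf.
Qed.

(** The set is nonempty because some Betti number is nonzero, and bounded because
    finitely many modules [F_i] are nonzero. *)
Lemma regularity_greatest :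
  greatest [set m | exists i j, betti F i j <> 0%N /\ m = j - i%:Z]
    (regularity F).
Proof.
have [j /alt_betti_neq0[i bij]] := alt_betti_exists.
have [b ub] := ubound_betti.
have [|x gx] := @greatest_exists _ (j - i%:Z) _ _ ub; first by exists i, j.
exact: xgetI gx.
Qed.

(** This is where the bound [i <= n] on the length of the resolution gives
    [0 <= D + 1]. *)
Lemma alt_betti_le_regularity j : chi j <> 0 -> j <= regularity F + n%:Z.
Proof.
case/alt_betti_neq0=> i bij; have [ilen _] := betti_neq0 bij.
have [_ ub] := regularity_greatest.
have /ub : [set m | exists i j, betti F i j <> 0%N /\ m = j - i%:Z] (j - i%:Z).
  by exists i, j.
lia.
Qed.

(** With [J] the last degree where the alternating sum of Betti numbers does
    not vanish, every summand of the difference vanishes for [s > J - n], and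
    only the one of [J] survives at [s = J - n]. *)
Lemma hilbert_regularityE J : greatest [set j | chi j <> 0] J ->
  hilbert_regularity G = J - n%:Z + 1.
Proof.
move=> [/= cJ maxJ].
have HP s : J - n%:Z < s -> (hilbert_function G s)%:R = P.[s%:~R] :> rat.
  move=> Js; apply/eqP; rewrite -subr_eq0 hilbert_function_sub big1 // => j _.
  have [->|/eqP cj] := eqVneq (chi j) 0; first by rewrite mul0r.
  rewrite monomials_polyE ?subrr ?mulr0 //.
  by have := maxJ j cj; lia.
have HJ : (hilbert_function G (J - n%:Z))%:R != P.[(J - n%:Z)%:~R] :> rat.
  have [i bij] := alt_betti_neq0 cJ; have [ilen [l lJ]] := betti_neq0 bij.
  rewrite -subr_eq0 hilbert_function_sub (bigD1_seq J) ?undup_uniq //=; last first.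
    by rewrite -lJ mem_degrees.
  rewrite [X in _ + X]big1 => [|j jJ]; last first.
    have [->|/eqP cj] := eqVneq (chi j) 0; first by rewrite mul0r.
    rewrite monomials_polyE ?subrr ?mulr0 //.
    by have := maxJ j cj; move/eqP: jJ; lia.
  rewrite addr0 addrAC subrr add0r mulf_neq0 //.
    by rewrite intr_eq0; apply/eqP.
  by rewrite subr_eq0 monomials_poly_opp.
have PE : hilbert_polynomial G = P.
  apply: xget_unique => [|q [s0 qH]].
    by exists (J - n%:Z + 1) => s Js; apply: HP; lia.
  apply: (@poly_eventually_eq _ _ (Num.max s0 (J - n%:Z + 1))) => s.
  by rewrite ge_max => /andP[s0s Js]; rewrite -qH // HP //; lia.
have least_r : least [set r : int | forall s : int, r <= s ->
    (hilbert_function G s)%:R = (hilbert_polynomial G).[s%:~R]] (J - n%:Z + 1).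
  rewrite PE; split=> [s Js|r Hr]; first by apply: HP; lia.
  rewrite leNgt; apply/negP => rJ; case/eqP: HJ; apply: Hr; lia.
apply: xget_unique => // r lr; exact: least_unique lr least_r.
Qed.

End Numerics.

Theorem theorem4p3 (k : fieldType) (n : nat) (M : lmodType {mpoly k[n]})
    (G : grading M) (F : min_free_resolution G)
    (M_neq0 : exists v : M, v != 0) (M_fg : finitely_generated M) :
  let D := regularity F - hilbert_regularity G in
  least [set lam : int | 0 <= lam /\
                         alt_betti F (regularity F + n%:Z - lam) <> 0]
        (D + 1).
Proof.
have [j cj] := alt_betti_exists F M_neq0.
have [|J gJ] := @greatest_exists [set j | alt_betti F j <> 0] j
    (regularity F + n%:Z) cj.
  by move=> i; apply: alt_betti_le_regularity.
have [cJ maxJ] := gJ.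
rewrite /= (hilbert_regularityE gJ).
have DE : regularity F - (J - n%:Z + 1) + 1 = regularity F + n%:Z - J by lia.
rewrite DE; split=> [|lam [_ /maxJ]]; last lia.
split; last by rewrite opprB addrC subrK.
by rewrite subr_ge0; apply: alt_betti_le_regularity.
Qed.
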